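(* Let $n > 2$ be an integer and let $A \in \mathbb{R}^{n\times 2}$ be a real matrix with orthonormal columns, i.e. $A^T A = I_2$. Then there exists a $2\times 2$ submatrix $Q$ of $A$ that is invertible and satisfies $\|Q^{-1}\|_2 \le \sqrt{n}$; equivalently, there exists a $2\times 2$ submatrix $Q$ of $A$ whose smallest singular value satisfies $\sigma_2(Q) \ge \frac{1}{\sqrt{n}}$.
   Context: A $2\times 2$ submatrix of an $n\times 2$ matrix $A$ is a matrix formed by two rows of $A$ with distinct indices $i\neq j$. $\|\cdot\|_2$ denotes the spectral norm (largest singular value), and $\sigma_2(Q)$ denotes the smallest singular value of a $2\times 2$ matrix $Q$. *)

(* Defs.v *)
From HB Require Import structures.
From mathcomp Require Import all_boot all_order all_algebra.
From mathcomp Require Import classical_sets reals.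
Set Implicit Arguments.
Unset Strict Implicit.
Unset Printing Implicit Defensive.
Import Order.TTheory GRing.Theory Num.Theory.
Local Open Scope classical_set_scope.
Local Open Scope ring_scope.

(** Singular values of a real square matrix: the nonnegative square roots of
    the eigenvalues of [Q^T *m Q]. *)
Definition singular_values (R : realType) (m : nat) (Q : 'M[R]_m) : set R :=
  [set s | 0 <= s /\ eigenvalue (Q^T *m Q) (s ^+ 2)].

(** [Q^T *m Q] is symmetric positive semidefinite, so for [0 < m] the set of
    singular values is finite and nonempty: the supremum and infimum below are
    a maximum and a minimum. *)
Definition spectral_norm (R : realType) (m : nat) (Q : 'M[R]_m) : R :=
  sup (singular_values Q).

Definition min_singular_value (R : realType) (m : nat) (Q : 'M[R]_m) : R :=
  inf (singular_values Q).

Definition row_pair (R : realType) (n : nat) (A : 'M[R]_(n, 2)) (i j : 'I_n) :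
    'M[R]_2 :=
  rowsub (tnth [tuple i; j]) A.

(* Main.v *)
Require Import Defs.
From HB Require Import structures.
From mathcomp Require Import all_boot all_order all_algebra.
From mathcomp Require Import ring lra.
From mathcomp Require Import classical_sets reals.
Set Implicit Arguments.
Unset Strict Implicit.
Unset Printing Implicit Defensive.
Import Order.TTheory GRing.Theory Num.Theory.
Local Open Scope ring_scope.

(** Write [z_i] for the rows of [A] and [t = 1/n]. A pair [i != j] is good when
    the Gram matrix of [z_i, z_j] is at least [t], that is, when the principal
    2 x 2 minor of [A A^T - t] at [i, j] is positive semidefinite
    ([gram_dominates]); both claims hold for the submatrix of any good pair.

    A good pair is found by reduction to three weighted rows. With weights
    [a_i = 1] the rows form a tight frame: [sum a_i z_i^T z_i] is a multiple of
    the identity, which amounts to the two linear equations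
    [sum a_i (x_i^2 - y_i^2) = 0] and [sum a_i x_i y_i = 0], and
    [sum a_i |z_i|^2 = 2 = 2 t sum a_i]. Maximizing [sum a_i |z_i|^2] over the
    nonnegative weights that satisfy these equations and have total weight [n]
    is a linear program with three equality constraints, so three rows carry a
    weighting that is at least as good ([basic_feasible_solution]): it is a
    tight frame [sum a_i z_i^T z_i = L] with [t sum a_i <= L].

    For three rows the Gram matrix of the vectors [sqrt(a_i) z_i] is [L] times a
    projection of corank one, so it equals [L (1 - w^T w)] for a unit vector
    [w]. With [m_i = L w_i^2], its diagonal is [L - m_i = a_i |z_i|^2] and its
    squared off-diagonal entries are [m_i m_j]. Putting
    [d_i = a_i (|z_i|^2 - t)], a pair with nonzero weights is good as soon as
    [d_i, d_j >= 0] and [m_i m_j <= d_i d_j]. Now [sum m_i = L <= sum d_i], so some [m_i <= d_i],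
    and comparing the sum over the two other indices gives a partner for that
    [i] ([dominating_partner], [dominating_pair], [tight_frame3]). *)

(** * Basic solutions of a linear program *)

(** As long as more than [d + 1] indices are allowed, the vectors [(u_i, 1)] on
    them are linearly dependent. Moving the weights along a dependency, in the
    direction that does not decrease the objective, keeps both constraints
    until a weight vanishes. Since the dependency has zero total, it has a
    negative coordinate in either direction, so this does happen. *)
Lemma basic_feasible_solution (R : realFieldType) (n d : nat)
    (u : 'I_n -> 'rV[R]_d) (c a : 'I_n -> R) (hn : (d.+1 <= n)%N) :
  (forall i, 0 <= a i) ->
  exists (T : {set 'I_n}) (b : 'I_n -> R),
    [/\ #|T| = d.+1, forall i, 0 <= b i & forall i, i \notin T -> b i = 0] /\
    [/\ \sum_i b i = \sum_i a i, \sum_i b i *: u i = \sum_i a i *: u i &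
        \sum_i a i * c i <= \sum_i b i * c i].
Proof.
move=> a0.
suff: forall k (S : {set 'I_n}) (a : 'I_n -> R), #|S| = (k + d.+1)%N ->
  (forall i, 0 <= a i) -> (forall i, i \notin S -> a i = 0) ->
  exists (T : {set 'I_n}) (b : 'I_n -> R),
    [/\ #|T| = d.+1, forall i, 0 <= b i & forall i, i \notin T -> b i = 0] /\
    [/\ \sum_i b i = \sum_i a i, \sum_i b i *: u i = \sum_i a i *: u i &
        \sum_i a i * c i <= \sum_i b i * c i].
  move/(_ (n - d.+1)%N [set: 'I_n] a); apply => //.
    by rewrite cardsT card_ord subnK.
  by move=> i; rewrite inE.
elim=> [|k IHk] S {a0}a cS a0 aS; first by exists S, a.
(* [be] is the dependency, already oriented along the objective. *)
have [be [beS be0 beu [i1 bei1]] bec] : exists2 be : 'I_n -> R,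
    [/\ forall i, i \notin S -> be i = 0, \sum_i be i = 0,
        \sum_i be i *: u i = 0 & exists i, be i < 0] & 0 <= \sum_i be i * c i.
  pose M : 'M[R]_(#|S|, d + 1) :=
    \matrix_(k < #|S|) row_mx (u (enum_val k)) 1%:M.
  have /rowV0Pn[v /sub_kermxP vM v0] : kermx M != 0.
    rewrite kermx_eq0 /row_free neq_ltn; apply/orP; left.
    by apply: (leq_ltn_trans (rank_leq_col M)); rewrite cS addn1 addSn ltnS leq_addl.
  pose be i := \sum_(l < #|S| | enum_val l == i) v 0 l.
  have beE (V : lmodType R) (F : 'I_n -> V) :
      \sum_i be i *: F i = \sum_l v 0 l *: F (enum_val l).
    rewrite [RHS](partition_big (fun l => enum_val l) xpredT) //=.
    apply: eq_bigr => i _; rewrite scaler_suml.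
    by apply: eq_bigr => l /eqP->.
  have beS i : i \notin S -> be i = 0.
    move=> iS; rewrite /be big_pred0 // => l; apply/negbTE.
    by apply: contraNneq iS => <-; apply: enum_valP.
  have vM' : row_mx (\sum_i be i *: u i) (\sum_i be i *: 1%:M) = 0 :> 'rV[R]_(d + 1).
    rewrite !beE -vM mulmx_sum_row.
    under [RHS]eq_bigr do rewrite rowK scale_row_mx.
    elim/big_rec3: _ => [|l x y z _ <-]; first by rewrite row_mx0.
    by rewrite add_row_mx.
  move: vM'; rewrite -[0 in RHS]row_mx0 => /eq_row_mx[beu /matrixP/(_ 0 0)].
  rewrite summxE mxE; under eq_bigr do rewrite !mxE /= mulr1.
  move=> be0.
  have [i bei] : exists i, be i != 0.
    apply/existsP; rewrite -negb_forall; apply: contra v0 => /forallP h.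
    apply/eqP/rowP=> l; rewrite mxE -(eqP (h (enum_val l))) /be.
    by rewrite (big_pred1 l) // => l'; rewrite /= (inj_eq enum_val_inj).
  have sgn (g : 'I_n -> R) : g i != 0 -> \sum_i g i = 0 -> exists j, g j < 0.
    move=> gi g0; apply/existsP; apply: contraR gi; rewrite negb_exists => /forallP h.
    have /psumr_eq0P := g0; move=> -> // j _; by rewrite leNgt.
  have [hc|hc] := leP 0 (\sum_i be i * c i).
    by exists be => //; split=> //; apply: sgn.
  exists (fun i => - be i); last first.
    by under eq_bigr do rewrite mulNr; rewrite sumrN oppr_ge0 ltW.
  split=> [j /beS->||| ]; first by rewrite oppr0.
  - by rewrite sumrN be0 oppr0.
  - by under eq_bigr do rewrite scaleNr; rewrite sumrN beu oppr0.
  - by apply: sgn; rewrite ?oppr_eq0 // sumrN be0 oppr0.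
(* The weight of [i0] is the first to vanish along [a + th * be]. *)
have [i0 /= bei0 i0min] := arg_minP (P := fun i => be i < 0) (fun i => a i / - be i) bei1.
pose th := a i0 / - be i0.
have th0 : 0 <= th by rewrite divr_ge0 // oppr_ge0 ltW.
pose b i := a i + th * be i.
have i0S : i0 \in S by apply: contraTT bei0 => /beS->; rewrite ltxx.
have bi0 : b i0 = 0.
  by rewrite /b /th invrN mulrN mulNr -mulrA mulVf ?mulr1 ?subrr // lt_eqF.
have bE (V : lmodType R) (F : 'I_n -> V) :
    \sum_i b i *: F i = \sum_i a i *: F i + th *: \sum_i be i *: F i.
  rewrite scaler_sumr -big_split /=; apply: eq_bigr => i _.
  by rewrite scalerDl scalerA.
have [||i|T [b' [hT [h1 h2 h3]]]] := IHk (S :\ i0) b.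
- by move: (cardsD1 i0 S); rewrite i0S cS addSn add1n => -[].
- move=> i; rewrite /b; have [hi|hi] := leP 0 (be i).
    by rewrite addr_ge0 // mulr_ge0.
  have := i0min i hi; rewrite -/th ler_pdivlMr ?oppr_gt0 //.
  by rewrite mulrN -subr_ge0 opprK.
- rewrite in_setD1 negb_and negbK => /orP[/eqP->//|iS].
  by rewrite /b aS // beS // mulr0 addr0.
exists T, b'; split=> //; split.
- by rewrite h1 big_split /= -mulr_sumr be0 mulr0 addr0.
- by rewrite h2 bE beu scaler0 addr0.
- apply: le_trans h3; have := bE R^o c; rewrite /GRing.scale /= => ->.
  by rewrite lerDl mulr_ge0.
Qed.

(** * Three weighted rows *)

(** If both partners failed, adding the two failures would give
    [d1 (L - d1) <= d1 (d2 + d3) < m1 (m2 + m3) = m1 (L - m1)], while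
    [m1 <= d1 <= L - m1] puts [d1] nearer than [m1] to the maximum of
    [x (L - x)]. *)
Lemma dominating_partner (R : realFieldType) (L m1 m2 m3 d1 d2 d3 : R) :
  0 < L -> 0 <= m1 -> 0 <= m2 -> 0 <= m3 -> m1 + m2 + m3 = L ->
  L <= d1 + d2 + d3 -> d1 <= L - m1 -> m1 <= d1 ->
  (0 <= d2 /\ m1 * m2 <= d1 * d2) \/ (0 <= d3 /\ m1 * m3 <= d1 * d3).
Proof.
move=> L0 m10 m20 m30 mL dL d1L md.
have [d1p|d1n] := ltP 0 d1; last first.
  have -> : d1 = 0 by lra.
  have -> : m1 = 0 by lra.
  by rewrite !mul0r; have [?|?] := leP 0 d2; [left|right]; split=> //; lra.
have aux d m : 0 <= m -> m1 * m <= d1 * d -> 0 <= d.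
  by move=> m0 h; rewrite -(pmulr_rge0 _ d1p); apply: le_trans h; apply: mulr_ge0.
have [h2|h2] := leP (m1 * m2) (d1 * d2); first by left; split=> //; apply: aux h2.
have [h3|h3] := leP (m1 * m3) (d1 * d3); first by right; split=> //; apply: aux h3.
have : (d1 - m1) * (L - d1 - m1) < 0.
  have : d1 * L <= d1 * (d1 + d2 + d3) by rewrite ler_pM2l.
  by rewrite -mL in h2 h3 *; nra.
by rewrite ltNge mulr_ge0 //; lra.
Qed.

(** The bounds [m_i < L] record that the selected indices have nonzero weight,
    so that the inequality can later be divided by the weights. When some
    [m_i = L], the other two [m_j] vanish and these two indices form the pair. *)
Lemma dominating_pair (R : realFieldType) (L m1 m2 m3 d1 d2 d3 : R) :
  0 < L -> 0 <= m1 -> 0 <= m2 -> 0 <= m3 -> m1 + m2 + m3 = L ->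
  L <= d1 + d2 + d3 -> d1 <= L - m1 -> d2 <= L - m2 -> d3 <= L - m3 ->
  [\/ [/\ m1 < L, m2 < L, 0 <= d1, 0 <= d2 & m1 * m2 <= d1 * d2],
      [/\ m1 < L, m3 < L, 0 <= d1, 0 <= d3 & m1 * m3 <= d1 * d3] |
      [/\ m2 < L, m3 < L, 0 <= d2, 0 <= d3 & m2 * m3 <= d2 * d3]].
Proof.
move=> L0 m10 m20 m30 mL dL h1 h2 h3.
have [m1L|m1L] := leP L m1.
  have [-> ->] : m2 = 0 /\ m3 = 0 by split; lra.
  by apply: Or33; rewrite mul0r mulr_ge0 //; [split=> //|..]; lra.
have [m2L|m2L] := leP L m2.
  have [-> ->] : m1 = 0 /\ m3 = 0 by split; lra.
  by apply: Or32; rewrite mul0r mulr_ge0 //; [split=> //|..]; lra.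
have [m3L|m3L] := leP L m3.
  have [-> ->] : m1 = 0 /\ m2 = 0 by split; lra.
  by apply: Or31; rewrite mul0r mulr_ge0 //; [split=> //|..]; lra.
have [md1|md1] := leP m1 d1.
  have d10 := le_trans m10 md1.
  case: (dominating_partner L0 m10 m20 m30 mL dL h1 md1) => -[? ?].
    by apply: Or31.
  by apply: Or32.
have [md2|md2] := leP m2 d2.
  have d20 := le_trans m20 md2.
  case: (@dominating_partner _ L m2 m1 m3 d2 d1 d3) => //; try lra; move=> -[? ?].
    by apply: Or31; split=> //; rewrite mulrC [leRHS]mulrC.
  by apply: Or33.
have md3 : m3 <= d3 by lra.
have d30 := le_trans m30 md3.
case: (@dominating_partner _ L m3 m1 m2 d3 d1 d2) => //; try lra; move=> -[? ?].
  by apply: Or32; split=> //; rewrite mulrC [leRHS]mulrC.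
by apply: Or33; split=> //; rewrite mulrC [leRHS]mulrC.
Qed.

(** The 2 x 2 matrix [G - t], with [G] the Gram matrix of [p] and [q], is positive
    semidefinite. *)
Definition gram_dominates (R : realFieldType) (t : R) (p q : R * R) : Prop :=
  [/\ t <= p.1 ^+ 2 + p.2 ^+ 2, t <= q.1 ^+ 2 + q.2 ^+ 2 &
      (p.1 * q.1 + p.2 * q.2) ^+ 2 <=
      (p.1 ^+ 2 + p.2 ^+ 2 - t) * (q.1 ^+ 2 + q.2 ^+ 2 - t)].

Lemma gram_dominates_unscale (R : realFieldType) (t L a b : R) (p q : R * R) :
  let r := p.1 ^+ 2 + p.2 ^+ 2 in let s := q.1 ^+ 2 + q.2 ^+ 2 in
  0 <= a -> 0 <= b -> L - a * r < L -> L - b * s < L ->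
  0 <= a * (r - t) -> 0 <= b * (s - t) ->
  a * b * (p.1 * q.1 + p.2 * q.2) ^+ 2 = (L - a * r) * (L - b * s) ->
  (L - a * r) * (L - b * s) <= a * (r - t) * (b * (s - t)) ->
  gram_dominates t p q.
Proof.
move=> r s a0 b0 har hbs hd he hE; rewrite -hE => h.
have a1 : 0 < a.
  by rewrite lt0r a0 andbT; apply: contraTneq har => ->; rewrite mul0r subr0 ltxx.
have b1 : 0 < b.
  by rewrite lt0r b0 andbT; apply: contraTneq hbs => ->; rewrite mul0r subr0 ltxx.
split.
- by move: hd; rewrite pmulr_rge0 // subr_ge0.
- by move: he; rewrite pmulr_rge0 // subr_ge0.
- by rewrite -(ler_pM2l (mulr_gt0 a1 b1)) (le_trans h) // -/r -/s mulrACA.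
Qed.

(** For [L = sum a_i z_i^T z_i], the determinant of [L - a_3 z_3^T z_3] is
    [L (L - a_3 |z_3|^2)], and by Cauchy-Binet it is also [a_1 a_2 det(z_1, z_2)^2].
    This shows [m_3 >= 0], and Lagrange's identity
    [(z_1 . z_2)^2 = |z_1|^2 |z_2|^2 - det(z_1, z_2)^2] turns it into
    [a_1 a_2 (z_1 . z_2)^2 = m_1 m_2]. *)
Lemma tight_frame3 (R : realFieldType) (t L a1 a2 a3 : R) (p q s : R * R) :
  0 < L -> 0 <= t -> 0 <= a1 -> 0 <= a2 -> 0 <= a3 -> t * (a1 + a2 + a3) <= L ->
  a1 * p.1 ^+ 2 + a2 * q.1 ^+ 2 + a3 * s.1 ^+ 2 = L ->
  a1 * p.2 ^+ 2 + a2 * q.2 ^+ 2 + a3 * s.2 ^+ 2 = L ->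
  a1 * (p.1 * p.2) + a2 * (q.1 * q.2) + a3 * (s.1 * s.2) = 0 ->
  [\/ gram_dominates t p q, gram_dominates t p s | gram_dominates t q s].
Proof.
case: p q s => [x1 y1] [x2 y2] [x3 y3] /= L0 t0 a10 a20 a30 hL hx hy hxy.
pose m (a x y : R) := L - a * (x ^+ 2 + y ^+ 2).
pose d (a x y : R) := a * (x ^+ 2 + y ^+ 2 - t).
have mE a b c x y x' y' x'' y'' :
    a * x ^+ 2 + b * x' ^+ 2 + c * x'' ^+ 2 = L ->
    a * y ^+ 2 + b * y' ^+ 2 + c * y'' ^+ 2 = L ->
    a * (x * y) + b * (x' * y') + c * (x'' * y'') = 0 ->
    L * m c x'' y'' = a * b * (x * y' - x' * y) ^+ 2.
  move=> e1 e2 e3.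
  transitivity ((L - c * x'' ^+ 2) * (L - c * y'' ^+ 2) - (c * (x'' * y'')) ^+ 2).
    by rewrite /m; ring.
  have -> : L - c * x'' ^+ 2 = a * x ^+ 2 + b * x' ^+ 2 by rewrite -e1; ring.
  have -> : L - c * y'' ^+ 2 = a * y ^+ 2 + b * y' ^+ 2 by rewrite -e2; ring.
  have -> : c * (x'' * y'') = - (a * (x * y) + b * (x' * y')).
    by apply/eqP; rewrite -subr_eq0 opprK addrC e3.
  by ring.
have m0 a b c x y x' y' x'' y'' : 0 <= a -> 0 <= b ->
    L * m c x'' y'' = a * b * (x * y' - x' * y) ^+ 2 -> 0 <= m c x'' y''.
  by move=> a0 b0 e; rewrite -(pmulr_rge0 _ L0) e mulr_ge0 ?sqr_ge0 ?mulr_ge0.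
have gE a b c x y x' y' x'' y'' :
    m a x y + m b x' y' + m c x'' y'' = L ->
    L * m c x'' y'' = a * b * (x * y' - x' * y) ^+ 2 ->
    a * b * (x * x' + y * y') ^+ 2 = m a x y * m b x' y'.
  move=> eL e.
  transitivity (a * (x ^+ 2 + y ^+ 2) * (b * (x' ^+ 2 + y' ^+ 2))
                - a * b * (x * y' - x' * y) ^+ 2); first by ring.
  have mc : m c x'' y'' = L - m a x y - m b x' y'.
    by apply/esym/eqP; rewrite -addrA -opprD subr_eq [eqbRHS]addrC eL.
  by rewrite -e mc /m; ring.
have e3 := mE _ _ _ _ _ _ _ _ _ hx hy hxy.
have e2 : L * m a2 x2 y2 = a1 * a3 * (x1 * y3 - x3 * y1) ^+ 2.
  by apply: mE; rewrite addrAC.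
have e1 : L * m a1 x1 y1 = a2 * a3 * (x2 * y3 - x3 * y2) ^+ 2.
  by apply: mE; rewrite addrC addrA.
have mL : m a1 x1 y1 + m a2 x2 y2 + m a3 x3 y3 = L.
  by rewrite /m; lra.
case: (@dominating_pair _ L (m a1 x1 y1) (m a2 x2 y2) (m a3 x3 y3)
        (d a1 x1 y1) (d a2 x2 y2) (d a3 x3 y3)) => //.
- exact: m0 e1.
- exact: m0 e2.
- exact: m0 e3.
- by rewrite /d; lra.
- by rewrite /d /m; have := mulr_ge0 a10 t0; lra.
- by rewrite /d /m; have := mulr_ge0 a20 t0; lra.
- by rewrite /d /m; have := mulr_ge0 a30 t0; lra.
- move=> [k1 k2 k3 k4 k5]; apply: Or31.
  by apply: (@gram_dominates_unscale _ t L a1 a2) => //; apply: gE e3.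
- move=> [k1 k2 k3 k4 k5]; apply: Or32.
  by apply: (@gram_dominates_unscale _ t L a1 a3) => //; apply: gE e2; rewrite addrAC.
- move=> [k1 k2 k3 k4 k5]; apply: Or33.
  apply: (@gram_dominates_unscale _ t L a2 a3) => //; apply: gE e1.
  by rewrite addrC addrA.
Qed.

(** * Singular values of 2 x 2 matrices *)

Lemma det_mx2 (R : comNzRingType) (M : 'M[R]_2) :
  \det M = M 0 0 * M 1 1 - M 0 1 * M 1 0.
Proof.
rewrite (expand_det_row _ 0) big_ord_recl big_ord1 /cofactor !det_mx11 !mxE /=.
have -> : lift ord0 0 = 1 :> 'I_2 by apply/val_inj.
have -> : lift 1 0 = 0 :> 'I_2 by apply/val_inj.
by rewrite expr0 mul1r /bump /= addn0 expr1 mulN1r mulrN.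
Qed.

Definition frobenius_sqr2 (R : nzRingType) (Q : 'M[R]_2) : R :=
  Q 0 0 ^+ 2 + Q 0 1 ^+ 2 + Q 1 0 ^+ 2 + Q 1 1 ^+ 2.

Lemma eigenvalue_gram2 (R : fieldType) (Q : 'M[R]_2) (mu : R) :
  eigenvalue (Q^T *m Q) mu =
  (mu ^+ 2 - frobenius_sqr2 Q * mu + (\det Q) ^+ 2 == 0).
Proof.
rewrite /eigenvalue /eigenspace kermx_eq0 row_free_unit unitmxE unitfE negbK.
congr (_ == _); rewrite !det_mx2 /frobenius_sqr2 !mxE !big_ord_recl !big_ord0 !mxE /=.
have -> : lift ord0 ord0 = 1 :> 'I_2 by apply/val_inj.
by rewrite !mulr1n !mulr0n; ring.
Qed.

Lemma gram_tr_eigenvalue2 (R : fieldType) (Q : 'M[R]_2) (mu : R) :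
  eigenvalue (Q *m Q^T) mu = eigenvalue (Q^T *m Q) mu.
Proof.
rewrite -[X in X *m _]trmxK !eigenvalue_gram2 det_tr /frobenius_sqr2 !mxE.
by congr (_ == _); ring.
Qed.

(** [(Q^-1)^T Q^-1] is the inverse of [Q Q^T]. *)
Lemma eigenvalue_gram_inv (R : fieldType) (m : nat) (Q : 'M[R]_m) (mu : R) :
  Q \in unitmx -> eigenvalue ((invmx Q)^T *m invmx Q) mu ->
  mu != 0 /\ eigenvalue (Q *m Q^T) mu^-1.
Proof.
move=> uQ /eigenvalueP[v hv v0].
have e : v = mu *: (v *m (Q *m Q^T)).
  rewrite scalemxAl -hv -!mulmxA (mulmxA (invmx Q)) mulVmx // mul1mx.
  by rewrite -trmx_mul mulmxV // trmx1 mulmx1.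
have mu0 : mu != 0 by apply: contraNneq v0 => mu0; rewrite e mu0 scale0r.
split=> //; apply/eigenvalueP; exists v => //.
by rewrite [in RHS]e scalerA mulVf // scale1r.
Qed.

(** [Q^T Q] and [Q Q^T] have the same characteristic polynomial [chi]. The
    hypothesis says that [chi t >= 0] and that [2 t] is at most the trace, and
    [chi t - chi mu = (t - mu) (t + mu - trace)] would be negative for
    [mu < t]. *)
Lemma gram_dominates_eigenvalue (R : realFieldType) (t : R) (Q : 'M[R]_2) (mu : R) :
  gram_dominates t (Q 0 0, Q 0 1) (Q 1 0, Q 1 1) ->
  eigenvalue (Q^T *m Q) mu -> t <= mu.
Proof.
rewrite eigenvalue_gram2 det_mx2 /frobenius_sqr2 => -[/= h1 h2 h3] /eqP hmu.
rewrite leNgt; apply/negP => mut.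
have : 0 <= (t - mu) * (t + mu - (Q 0 0 ^+ 2 + Q 0 1 ^+ 2 + Q 1 0 ^+ 2 + Q 1 1 ^+ 2)).
  rewrite -subr_ge0 in h3; apply: (le_trans h3); rewrite -[leRHS]addr0 -hmu.
  by rewrite le_eqVlt; apply/orP; left; apply/eqP; ring.
by rewrite leNgt pmulr_rlt0 ?subr_gt0 //; lra.
Qed.

Lemma gram_dominates_unit (R : realFieldType) (t : R) (Q : 'M[R]_2) :
  0 < t -> gram_dominates t (Q 0 0, Q 0 1) (Q 1 0, Q 1 1) -> Q \in unitmx.
Proof.
move=> t0 hQ; rewrite unitmxE unitfE; apply/negP => /eqP hd.
have : eigenvalue (Q^T *m Q) 0 by rewrite eigenvalue_gram2 hd !expr0n mulr0 subr0 addr0.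
by move/(gram_dominates_eigenvalue hQ); rewrite leNgt t0.
Qed.

(** The supremum and infimum of the empty set are [0], so the bounds below need
    an actual singular value. The larger root of the characteristic polynomial
    of [Q^T Q] gives one: its discriminant is a sum of squares. *)
Lemma singular_values2_nonempty (R : realType) (Q : 'M[R]_2) :
  (singular_values Q !=set0)%classic.
Proof.
pose T := frobenius_sqr2 Q; pose D := \det Q.
have T0 : 0 <= T by rewrite /T /frobenius_sqr2 !addr_ge0 // sqr_ge0.
have disc : 0 <= T ^+ 2 - 4 * D ^+ 2.
  have -> : T ^+ 2 - 4 * D ^+ 2 =
      (Q 0 0 ^+ 2 + Q 1 0 ^+ 2 - Q 0 1 ^+ 2 - Q 1 1 ^+ 2) ^+ 2 +
      4 * (Q 0 0 * Q 0 1 + Q 1 0 * Q 1 1) ^+ 2.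
    by rewrite /T /D det_mx2 /frobenius_sqr2; ring.
  by rewrite addr_ge0 ?sqr_ge0 // mulr_ge0 ?sqr_ge0.
exists (Num.sqrt ((T + Num.sqrt (T ^+ 2 - 4 * D ^+ 2)) / 2)); split.
  exact: sqrtr_ge0.
rewrite sqr_sqrtr; last by apply: divr_ge0 => //; apply: addr_ge0 => //; apply: sqrtr_ge0.
rewrite eigenvalue_gram2 -/T -/D.
have := sqr_sqrtr disc; set r := Num.sqrt _ => hr.
apply/eqP; transitivity ((r ^+ 2 - (T ^+ 2 - 4 * D ^+ 2)) / 4); first by field.
by rewrite hr subrr mul0r.
Qed.

Lemma gram_dominates_min_singular_value (R : realType) (t : R) (Q : 'M[R]_2) :
  gram_dominates t (Q 0 0, Q 0 1) (Q 1 0, Q 1 1) ->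
  Num.sqrt t <= min_singular_value Q.
Proof.
move=> hQ; apply: lb_le_inf; first exact: singular_values2_nonempty.
move=> s [s0 /(gram_dominates_eigenvalue hQ) hs].
by rewrite -(ger0_norm s0) -sqrtr_sqr ler_wsqrtr.
Qed.

Lemma gram_dominates_spectral_norm_inv (R : realType) (t : R) (Q : 'M[R]_2) :
  0 < t -> gram_dominates t (Q 0 0, Q 0 1) (Q 1 0, Q 1 1) ->
  spectral_norm (invmx Q) <= Num.sqrt t^-1.
Proof.
move=> t0 hQ; apply: ge_sup; first exact: singular_values2_nonempty.
move=> s [s0 /(eigenvalue_gram_inv (gram_dominates_unit t0 hQ))[s2]].
rewrite gram_tr_eigenvalue2 => /(gram_dominates_eigenvalue hQ) hs.
rewrite -[leLHS](ger0_norm s0) -sqrtr_sqr ler_wsqrtr //.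
have s2p : 0 < s ^+ 2 by rewrite lt0r s2 sqr_ge0.
by rewrite -[leLHS]invrK lef_pV2 // posrE invr_gt0.
Qed.

(** * The dominating pair of rows *)

Lemma orthonormal_dominating_pair (R : realFieldType) (n : nat) (A : 'M[R]_(n, 2)) :
  (2 < n)%N -> A^T *m A = 1%:M ->
  exists i j : 'I_n,
    i != j /\ gram_dominates n%:R^-1 (A i 0, A i 1) (A j 0, A j 1).
Proof.
move=> hn hA; set t : R := n%:R^-1.
have n0 : (0 : R) < n%:R by rewrite ltr0n (ltn_trans _ hn).
have t0 : 0 < t by rewrite invr_gt0.
have AE k l : \sum_i A i k * A i l = (k == l)%:R.
  have /matrixP/(_ k l) := hA; rewrite !mxE => <-.
  by apply: eq_bigr => i _; rewrite mxE.
(* [u] is the traceless part of [z_i^T z_i], whose weighted sum vanishes exactly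
   for tight frames. The offset [2 * t] makes the objective zero at [a = 1]. *)
pose u (i : 'I_n) : 'rV[R]_2 :=
  \row_k (if k == 0 then A i 0 * A i 0 - A i 1 * A i 1 else A i 0 * A i 1).
pose c (i : 'I_n) : R := A i 0 * A i 0 + A i 1 * A i 1 - 2 * t.
have [T [b [[cT b0 bT] [b1 bu bc]]]] :=
  basic_feasible_solution u c hn (fun _ => ler01 : 0 <= 1 :> R).
have {bu}[bu0 bu1] : \sum_i b i * (A i 0 * A i 0 - A i 1 * A i 1) = 0 /\
    \sum_i b i * (A i 0 * A i 1) = 0.
  split.
    have /rowP/(_ 0) := bu; rewrite !summxE.
    under eq_bigr do rewrite !mxE /=.
    under [X in _ = X]eq_bigr do rewrite !mxE /= mul1r.
    by move=> ->; rewrite sumrB !AE subrr.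
  have /rowP/(_ 1) := bu; rewrite !summxE.
  under eq_bigr do rewrite !mxE /=.
  under [X in _ = X]eq_bigr do rewrite !mxE /= mul1r.
  by move=> ->; rewrite AE.
have bS : \sum_i b i = n%:R by rewrite b1 sumr_const card_ord.
have {}bc : 2 <= \sum_i b i * (A i 0 * A i 0 + A i 1 * A i 1).
  have : 0 <= \sum_i b i * c i.
    apply: le_trans bc; under eq_bigr do rewrite mul1r.
    rewrite sumrB big_split /= !AE /= sumr_const card_ord -[_ *+ n]mulr_natl.
    by rewrite mulrCA mulfV ?gt_eqF // mulr1 subrr.
  rewrite /c; under eq_bigr do rewrite mulrBr.
  by rewrite sumrB -mulr_suml bS mulrCA mulfV ?gt_eqF // mulr1 subr_ge0.
have [i [j [k [uT TE]]]] : exists i j k, uniq [:: i; j; k] /\ enum T = [:: i; j; k].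
  move: (enum_uniq T) cT; rewrite cardE.
  by case: (enum T) => [|i [|j [|k []]]] //= uT _; exists i, j, k.
have sumT (F : 'I_n -> R) : \sum_i b i * F i = b i * F i + b j * F j + b k * F k.
  rewrite -addrA (bigID (mem T)) /= [X in _ + X]big1 ?addr0.
    by rewrite -big_enum TE !big_cons big_nil /= addr0.
  by move=> l /bT->; rewrite mul0r.
have sumb : \sum_i b i = b i + b j + b k.
  by have := sumT (fun=> 1); under eq_bigr do rewrite mulr1; rewrite !mulr1.
rewrite !sumT in bu0 bu1 bc; rewrite sumb in bS.
pose L := b i * A i 0 ^+ 2 + b j * A j 0 ^+ 2 + b k * A k 0 ^+ 2.
have L1 : 1 <= L by rewrite /L; lra.
move: uT; rewrite /= !inE negb_or andbT => /andP[/andP[ij ik] jk].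
have : [\/ gram_dominates t (A i 0, A i 1) (A j 0, A j 1),
           gram_dominates t (A i 0, A i 1) (A k 0, A k 1)
         | gram_dominates t (A j 0, A j 1) (A k 0, A k 1)].
  apply: (@tight_frame3 _ t L (b i) (b j) (b k)) => //=.
  - exact: lt_le_trans ltr01 L1.
  - exact: ltW.
  - by rewrite bS mulVf // gt_eqF.
  - by rewrite /L; lra.
by case=> h; [exists i, j | exists i, k | exists j, k].
Qed.

Theorem mainTheorem1 (R : realType) (n : nat) (A : 'M[R]_(n, 2))
    (hn : (2 < n)%N) (hA : A^T *m A = 1%:M) :
  (exists i j : 'I_n,
     [/\ i != j,
         row_pair A i j \in unitmx &
         spectral_norm (invmx (row_pair A i j)) <= Num.sqrt n%:R]) /\
  (exists i j : 'I_n,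
     i != j /\ 1 / Num.sqrt n%:R <= min_singular_value (row_pair A i j)).
Proof.
have [i [j [ij hij]]] := orthonormal_dominating_pair hn hA.
have t0 : (0 : R) < n%:R^-1 by rewrite invr_gt0 ltr0n (ltn_trans _ hn).
have hQ : gram_dominates n%:R^-1 (row_pair A i j 0 0, row_pair A i j 0 1)
    (row_pair A i j 1 0, row_pair A i j 1 1) by rewrite !mxE.
split; exists i, j; split=> //.
- exact: gram_dominates_unit t0 hQ.
- by rewrite -[n%:R]invrK; apply: gram_dominates_spectral_norm_inv.
- by rewrite div1r -sqrtrV ?ler0n //; apply: gram_dominates_min_singular_value.
Qed.
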